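(* The set of Nyldon words over $A$, equipped with the decreasing lexicographic order $>_{\mathrm{lex}}$ (that is, with the total order $\prec$ defined by $u\prec v$ if and only if $u>_{\mathrm{lex}}v$), is a right Lazard set.
   Context: $A$ is a finite alphabet of cardinality at least $2$ with a total order $<$. $A^*$ (resp. $A^+$) is the set of finite (resp. nonempty finite) words over $A$, $|w|$ is the length of $w$, and $A^{\le n}$ is the set of words of length at most $n$. The lexicographic order $<_{\mathrm{lex}}$ on $A^*$ is the total order given by: $u<_{\mathrm{lex}}v$ if $u$ is a proper prefix of $v$, or there exist letters $i<j$ and a word $p$ such that $pi$ is a prefix of $u$ and $pj$ is a prefix of $v$; $u\le_{\mathrm{lex}}v$ means $u<_{\mathrm{lex}}v$ or $u=v$. Nyldon words are defined recursively on length: every letter (word of length $1$) is Nyldon; a word $w$ of length at least $2$ is Nyldon if and only if there is no sequence $(n_1,\ldots,n_k)$ of Nyldon words with $w=n_1\cdots n_k$, $\max\{|n_1|,\ldots,|n_k|\}<|w|$ and $n_1\le_{\mathrm{lex}}\cdots\le_{\mathrm{lex}}n_k$. The empty word is not Nyldon. A right Lazard set is a subset $F$ of $A^+$ endowed with a total order $\prec$ such that, for any integer $n\ge1$, if $F\cap A^{\le n}=\{u_1,\ldots,u_k\}$ with $k\ge 1$ and $u_1\succ\cdots\succ u_k$, and if one sets $Y_1=A$ and $Y_{i+1}=(Y_i\setminus\{u_i\})u_i^*=\{y\,u_i^j: y\in Y_i\setminus\{u_i\},\ j\ge 0\}$ for $i\ge 1$, then (i) $u_i\in Y_i$ for every $i\in\{1,\ldots,k\}$,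 and (ii) $Y_k\cap A^{\le n}=\{u_k\}$. *)

(* Defs.v *)
(* A word over A is a [seq A]. *)
From mathcomp Require Import all_boot all_order.
From mathcomp Require Import classical_sets.

Set Implicit Arguments.
Unset Strict Implicit.
Unset Printing Implicit Defensive.

Import Order.TTheory.
Local Open Scope classical_set_scope.

Section Lexicographic.
Context {d : Order.disp_t} {A : orderType d}.
Implicit Types (u v p : seq A) (i j : A).

(* [seqlexi A] is the library's alias of [seq A] carrying the lexicographic
   order, for which a proper prefix is smaller. *)
Definition lex_le : rel (seq A) := fun u v => ((u : seqlexi A) <= v)%O.
Definition lex_lt : rel (seq A) := fun u v => ((u : seqlexi A) < v)%O.
Definition lex_gt : rel (seq A) := fun u v => lex_lt v u.

Lemma lex_ltP u v :
  lex_lt u v <-> (prefix u v && (u != v)) \/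
    exists i j p, [/\ (i < j)%O, prefix (rcons p i) u & prefix (rcons p j) v].
Proof.
rewrite /lex_lt; elim: u v => [|x u IH] [|y v].
- rewrite ltxx; split=> // -[//|[i [j [p [_ pu _]]]]].
  by case: p pu.
- by split=> // _; left.
- split=> // -[//|[i [j [p [_ _ pv]]]]].
  by case: p pv.
- rewrite ltxi_cons prefix_cons eqseq_cons; case: (ltgtP x y) => [xy|yx|<-{y}].
  + by split=> // _; right; exists x, y, [::]; rewrite /= !eqxx !prefix0s.
  + split=> // -[|[i [j [[|z p] [ij /= /andP[/eqP e1 _] /andP[/eqP e2 _]]]]]].
    * by [].
    * by rewrite e1 e2 in ij; move: (lt_trans ij yx); rewrite ltxx.
    * by rewrite -e1 -e2 ltxx in yx.
  + rewrite /=; split.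
      move=> /IH[h|[i [j [p [ij pu pv]]]]]; first by left.
      by right; exists i, j, (x :: p); rewrite /= !eqxx.
    case=> [h|[i [j [[|z p] [ij /= /andP[/eqP e1 pu] /andP[/eqP e2 pv]]]]]].
    * by apply/IH; left.
    * by rewrite e1 e2 ltxx in ij.
    * by apply/IH; right; exists i, j, p.
Qed.

Lemma lex_leE u v : lex_le u v = (u == v) || lex_lt u v.
Proof. exact: le_eqVlt. Qed.

End Lexicographic.

Section Nyldon.
Context {d : Order.disp_t} {A : orderType d}.
Implicit Types (w : seq A) (s : seq (seq A)).

(* The recursion is on an upper bound n of the length of w; [nyldonP] shows that
   [nyldon] satisfies the defining equation of Nyldon words. *)
Fixpoint nyldon_upto (n : nat) (w : seq A) : Prop :=
  if n is n'.+1 then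
    size w = 1 \/
    1 < size w /\
      ~ exists s, [/\ w = flatten s,
                      forall m, m \in s -> nyldon_upto n' m,
                      forall m, m \in s -> size m < size w
                    & sorted lex_le s]
  else False.

Definition nyldon : set (seq A) := [set w | nyldon_upto (size w) w].

Lemma nyldon_uptoE n w : size w <= n -> nyldon_upto n w <-> nyldon w.
Proof.
rewrite /nyldon /=; elim/ltn_ind: n w => -[|n] IH w.
  by rewrite leqn0 => /eqP->.
move=> wn; case E: (size w) => [|k] /=.
  by rewrite E; split=> // -[|[]].
have kn : k <= n by rewrite -ltnS -E.
have eqk m : size m < size w -> nyldon_upto n m <-> nyldon_upto k m.
  rewrite E ltnS => mk; rewrite (IH n) ?(leq_trans mk) //.
  by rewrite (IH k) // ltnS.
split=> -[->|[w1 h]]; [by left|right|by left|right]; split=> //;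
  by move=> [s [ws ns ms ss]]; apply: h; exists s; split=> // m mins;
     rewrite ?E ?ms //; try (apply/eqk; last exact: ns);
     rewrite -?E ms.
Qed.

Lemma nyldonP w :
  nyldon w <->
  size w = 1 \/
  1 < size w /\
    ~ exists s, [/\ w = flatten s,
                    forall m, m \in s -> nyldon m,
                    forall m, m \in s -> size m < size w
                  & sorted lex_le s].
Proof.
rewrite -(nyldon_uptoE (leqnSn (size w))) /=.
split=> -[->|[w1 h]]; [by left|right|by left|right]; split=> //;
  move=> [s [ws ns ms ss]]; apply: h; exists s; split=> // m mins;
  by apply/(nyldon_uptoE (ltnW (ms m mins))); exact: ns.
Qed.

End Nyldon.

Section Lazard.
Context {A : eqType}.
Implicit Types (F Y : set (seq A)) (u y w : seq A) (us : seq (seq A)).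

Definition words_upto (n : nat) : set (seq A) := [set w | size w <= n].

(* (Y \ {u}) u^* *)
Definition lazard_step Y u : set (seq A) :=
  [set y ++ flatten (nseq j u) | y in Y `\ u & j in [set: nat]].

(* Indices start at 0: [lazard_set us i] is Y_(i+1) and [nth [::] us i] is
   u_(i+1). *)
Fixpoint lazard_set us (i : nat) : set (seq A) :=
  if i is i'.+1 then lazard_step (lazard_set us i') (nth [::] us i')
  else [set w | size w = 1].

Definition strict_total_order_on F (prec : rel (seq A)) : Prop :=
  [/\ forall u, F u -> ~~ prec u u,
      forall u v w, F u -> F v -> F w -> prec u v -> prec v w -> prec u w
    & forall u v, F u -> F v -> u <> v -> prec u v \/ prec v u].

Definition right_lazard F (prec : rel (seq A)) : Prop :=
  [/\ F `<=` [set w | w <> [::]],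
      strict_total_order_on F prec
    & forall (n : nat) us,
        1 <= n -> 1 <= size us ->
        F `&` words_upto n = [set` us] ->
        sorted (fun u v => prec v u) us ->
        (forall i, i < size us -> lazard_set us i (nth [::] us i)) /\
        lazard_set us (size us).-1 `&` words_upto n = [set last [::] us]].

End Lazard.

(* Main.v *)
Require Import Defs.
From mathcomp Require Import all_boot all_order.
From mathcomp Require Import boolp classical_sets.

Set Implicit Arguments.
Unset Strict Implicit.
Unset Printing Implicit Defensive.

(** Lazard elimination removes a word [u] from a code [Y] and puts
    [(Y \ {u}) u^*] in its place.  Start from the letters and always remove the
    lexicographically least word of length at most [n] that is left.  A new word
    [y u^j] has [y] as a prefix, so it lies above [y], which lies above [u]: the
    words come out in strictly increasing order.  As there are finitely many
    words of length at most [n], the process ends, with no word of length at most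
    [n] left ([exhausts_exists]).

    Let [vs] be the increasing list of removed words.  Each elimination step is
    the unambiguous product [Y^* = u^* ((Y \ {u}) u^* )^*], so every word of length
    at most [n] is the product of exactly one nondecreasing sequence of members of
    [vs] ([exhausts_factor], [exhausts_factor_uniq]).  By induction on the
    length, [vs] consists of the Nyldon words of length at most [n]
    ([exhausts_nyldon]): a member of [vs] has no second nondecreasing
    factorization, hence none into shorter Nyldon words; a word outside [vs] has
    one, whose factors are shorter members of [vs].

    A strictly increasing list is determined by its members, so the list of
    Nyldon words in the definition of a right Lazard set is [vs], and the two
    conditions to be checked describe how [vs] was made. *)

Import Order.TTheory.
Local Open Scope classical_set_scope.

(** * Lazard elimination as an unambiguous product *)

Section Elimination.
Context {A : eqType}.
Implicit Types (Y : set (seq A)) (u v w y : seq A) (s t us vs : seq (seq A)).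

Lemma lazard_stepP Y u w :
  lazard_step Y u w <->
  exists y j, [/\ Y y, y <> u & w = y ++ flatten (nseq j u)].
Proof.
split=> [[y [Yy yu] [j _ <-]]|[y [j [Yy yu ->]]]]; first by exists y, j.
by exists y => //; exists j.
Qed.

Definition seq_over Y s := forall y, y \in s -> Y y.

Lemma seq_over_cons Y y s : seq_over Y (y :: s) <-> Y y /\ seq_over Y s.
Proof.
split=> [h|[Yy h] z]; last by rewrite inE => /predU1P[->|/h].
by split=> [|z zs]; apply: h; rewrite inE ?eqxx ?zs ?orbT.
Qed.

Lemma seq_over_cat Y s t : seq_over Y s -> seq_over Y t -> seq_over Y (s ++ t).
Proof. by move=> hs ht y; rewrite mem_cat => /orP[/hs|/ht]. Qed.

Lemma seq_over_nseq Y j u : Y u -> seq_over Y (nseq j u).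
Proof. by move=> Yu y; rewrite mem_nseq => /andP[_ /eqP->]. Qed.

Definition code Y :=
  forall s t, seq_over Y s -> seq_over Y t -> flatten s = flatten t -> s = t.

Lemma code_letters : code [set w : seq A | size w = 1].
Proof.
elim=> [|x s IH] [|y t] //=.
- by move=> _ /seq_over_cons[]; case: y.
- by move=> /seq_over_cons[]; case: x.
move=> /seq_over_cons[x1 hs] /seq_over_cons[y1 ht].
case: x x1 => [|a []] // _; case: y y1 => [|b []] // _ /= [->].
by move=> /(IH _ hs ht)->.
Qed.

(** The expression of a sequence over [Y] as [u^j] followed by a sequence over
    [(Y \ {u}) u^*]: every maximal run of [u] is attached to the word on its
    left, and [j] is the length of the initial run. *)
Fixpoint regroup u s : nat * seq (seq A) :=
  if s is y :: s' then
    let r := regroup u s' in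
    if y == u then (r.1.+1, r.2) else (0, (y ++ flatten (nseq r.1 u)) :: r.2)
  else (0, [::]).

Lemma regroup_flatten u s :
  flatten s = flatten (nseq (regroup u s).1 u) ++ flatten (regroup u s).2.
Proof.
elim: s => //= y s ->; case: eqP => [->|_] /=; by rewrite catA.
Qed.

Lemma regroup_over Y u s :
  seq_over Y s -> seq_over (lazard_step Y u) (regroup u s).2.
Proof.
elim: s => [|y s IH] //= /seq_over_cons[Yy /IH hs].
case: eqP => //= yu; apply/seq_over_cons; split=> //.
by apply/lazard_stepP; exists y, (regroup u s).1.
Qed.

Lemma regroup_nseq u j s :
  regroup u (nseq j u ++ s) = (j + (regroup u s).1, (regroup u s).2).
Proof.
by elim: j => [|j /= ->]; rewrite ?eqxx //; case: (regroup u s).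
Qed.

(** Regrouping is onto, which makes the product [u^* ((Y \ {u}) u^* )^*]
    unambiguous as soon as [Y] is a code. *)
Lemma regroup_onto Y u j s :
  Y u -> seq_over (lazard_step Y u) s ->
  exists t, [/\ seq_over Y t, flatten t = flatten (nseq j u) ++ flatten s
              & regroup u t = (j, s)].
Proof.
move=> Yu; elim: s j => [|x s IH] j.
  move=> _; exists (nseq j u); split; first exact: seq_over_nseq.
    by rewrite cats0.
  by rewrite -[nseq j u]cats0 regroup_nseq addn0.
move=> /seq_over_cons[/lazard_stepP[y [i [Yy yu ->]]] /(IH i)[t [ht ft rt]]].
exists (nseq j u ++ y :: t); split.
- by apply: seq_over_cat; [exact: seq_over_nseq|exact/seq_over_cons].
- by rewrite flatten_cat /= ft !catA.
- by rewrite regroup_nseq /= rt; case: eqP; rewrite //= addn0.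
Qed.

Lemma lazard_step_uniq Y u i j s t :
  code Y -> Y u ->
  seq_over (lazard_step Y u) s -> seq_over (lazard_step Y u) t ->
  flatten (nseq i u) ++ flatten s = flatten (nseq j u) ++ flatten t ->
  i = j /\ s = t.
Proof.
move=> cY Yu /(regroup_onto i Yu)[s' [hs <- rs]].
move=> /(regroup_onto j Yu)[t' [ht <- rt]] /(cY _ _ hs ht) st.
by move: rs; rewrite st rt => -[-> ->].
Qed.

Lemma code_lazard_step Y u : code Y -> Y u -> code (lazard_step Y u).
Proof.
move=> cY Yu s t hs ht st.
by have [] := @lazard_step_uniq Y u 0 0 s t cY Yu hs ht st.
Qed.

(** [vs] can be eliminated from [Y] in this order, and this leaves no word of
    length at most [n]. *)
Fixpoint exhausts (n : nat) Y vs : Prop :=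
  if vs is v :: vs' then Y v /\ exhausts n (lazard_step Y v) vs'
  else forall y, Y y -> n < size y.

Lemma seq_over_lazard_step Y u s :
  Y u -> seq_over (lazard_step Y u) s ->
  exists2 t, seq_over Y t & flatten t = flatten s.
Proof. by move=> Yu /(regroup_onto 0 Yu)[t [ht ft _]]; exists t. Qed.

(** The factors produced by later eliminations are still products over the code
    [Y]; this is what lets the unambiguity of one step at [Y] be applied to a
    factorization over all of [vs]. *)
Lemma exhausts_star n Y vs s :
  exhausts n Y vs -> seq_over [set` vs] s ->
  exists2 t, seq_over Y t & flatten t = flatten s.
Proof.
elim: vs Y s => [|v vs IH] Y s /=.
  by case: s => [|x s] _ hs; [exists [::]|have := hs x (mem_head _ _)].
move=> [Yv /IH{}IH]; elim: s => [|x s IHs]; first by exists [::].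
move=> /seq_over_cons[xv /IHs[t ht ft]].
have [->|xnv] := eqVneq x v.
  by exists (v :: t); [exact/seq_over_cons|rewrite /= ft].
have /IH[t1 ht1 /= ft1] : seq_over [set` vs] [:: x].
  apply/seq_over_cons; split=> //.
  by move: xv => /=; rewrite inE (negPf xnv).
have [t2 ht2 ft2] := seq_over_lazard_step Yv ht1.
exists (t2 ++ t); first exact: seq_over_cat.
by rewrite flatten_cat ft2 ft1 ft cats0.
Qed.

Lemma lazard_setE us i : i <= size us ->
  lazard_set us i =
  foldl lazard_step [set w : seq A | size w = 1] (take i us).
Proof.
elim: i => [|i IH] hi; first by rewrite take0.
by rewrite /= IH ?(ltnW hi) // (take_nth [::] hi) foldl_rcons.
Qed.

Lemma exhausts_nth n Y us i : exhausts n Y us -> i < size us ->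
  foldl lazard_step Y (take i us) (nth [::] us i).
Proof. by elim: us Y i => [|u us IH] Y [|i] //= [Yu ex]; [|exact: IH]. Qed.

Lemma exhausts_foldl n Y us : exhausts n Y us ->
  forall y, foldl lazard_step Y us y -> n < size y.
Proof. by elim: us Y => [|u us IH] Y //= [_ /IH]. Qed.

End Elimination.

(** * Elimination in increasing lexicographic order *)

Section Increasing.
Context {d : Order.disp_t} {A : orderType d}.
Implicit Types (Y : set (seq A)) (u v w y : seq A) (s t us vs ws : seq (seq A)).

Lemma lex_lt_irr : irreflexive (@lex_lt d A).
Proof. by move=> u; rewrite /lex_lt ltxx. Qed.

Lemma lex_lt_trans : transitive (@lex_lt d A).
Proof. by move=> v u w; rewrite /lex_lt; exact: lt_trans. Qed.

Lemma lex_le_trans : transitive (@lex_le d A).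
Proof. by move=> v u w; rewrite /lex_le; exact: le_trans. Qed.

Lemma lex_lt_le_trans v u w : lex_lt u v -> lex_le v w -> lex_lt u w.
Proof. exact: lt_le_trans. Qed.

Lemma lex_ltW u v : lex_lt u v -> lex_le u v.
Proof. exact: ltW. Qed.

Lemma lex_le_cat u v : lex_le u (u ++ v).
Proof.
rewrite lex_leE; case: eqVneq => //= ne; apply/lex_ltP; left.
by rewrite prefix_prefix ne.
Qed.

Lemma lex_lt_sorted_cons v vs :
  sorted lex_lt (v :: vs) ->
  sorted lex_lt vs /\ (forall x, x \in vs -> lex_lt v x).
Proof.
rewrite /= (path_sortedE lex_lt_trans) => /andP[/allP h ->].
by split.
Qed.

(** [ws] plays the part of the words of length at most [n] from some point on.
    It is scanned upwards: a word that is still in [Y] when it is reached is the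
    least one left, and is eliminated.  The words that this creates are above it,
    hence further on in [ws]. *)
Lemma exhausts_exists n Y ws :
  sorted lex_lt ws ->
  (forall x y, x \in ws -> lex_le x y -> size y <= n -> y \in ws) ->
  (forall y, Y y -> size y <= n -> y \in ws) ->
  exists2 vs, subseq vs ws & exhausts n Y vs.
Proof.
elim: ws Y => [|w ws IH] Y.
  move=> _ _ hY; exists [::] => //= y Yy.
  by rewrite ltnNge; apply/negP => /(hY y Yy).
move=> /lex_lt_sorted_cons[sws wlt] up hY.
have up' x y : x \in ws -> lex_le x y -> size y <= n -> y \in ws.
  move=> xws xy yn; have wy : lex_lt w y := lex_lt_le_trans (wlt x xws) xy.
  have := up x y _ xy yn; rewrite !inE xws orbT => /(_ isT)/predU1P[yw|//].
  by rewrite yw lex_lt_irr in wy.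
have [Yw|nYw] := pselect (Y w); last first.
  have [y Yy yn|vs sub ex] := IH Y sws up'.
    by have := hY y Yy yn; rewrite inE => /predU1P[yw|//]; rewrite yw in Yy.
  by exists vs => //; exact: subseq_trans sub (subseq_cons _ _).
have [|vs sub ex] := IH (lazard_step Y w) sws up'; last first.
  by exists (w :: vs) => //=; rewrite eqxx.
move=> z /lazard_stepP[y [j [Yy yw ->]]] zn.
have yn : size y <= n by apply: leq_trans zn; rewrite size_cat leq_addr.
have := hY y Yy yn; rewrite inE => /predU1P[//|yws].
by apply: (up' y) => //; exact: lex_le_cat.
Qed.

(** Each step extracts the initial run of the least word, and the rest is
    factored over the later words, which are larger.  At the end nothing remains,
    since every word still available is longer than [n]. *)
Lemma exhausts_factor n Y vs s :
  sorted lex_lt vs -> exhausts n Y vs -> seq_over Y s ->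
  size (flatten s) <= n ->
  exists t, [/\ seq_over [set` vs] t, sorted lex_le t & flatten t = flatten s].
Proof.
elim: vs Y s => [|v vs IH] Y s.
  case: s => [|x s] _ /= h; first by exists [::].
  move=> /seq_over_cons[/h xn _]; rewrite size_cat => le.
  by have := leq_ltn_trans (leq_trans (leq_addr _ _) le) xn; rewrite ltnn.
move=> /lex_lt_sorted_cons[svs vlt] [Yv ex] hs.
rewrite (regroup_flatten v) size_cat => le.
have [t [ht st ft]] :=
  IH _ _ svs ex (@regroup_over _ Y v s hs) (leq_trans (leq_addl _ _) le).
exists (nseq (regroup v s).1 v ++ t); split.
- move=> y; rewrite mem_cat mem_nseq => /orP[/andP[_ /eqP->]|/ht] /=.
    exact: mem_head.
  by rewrite inE => ->; rewrite orbT.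
- elim: (regroup v s).1 => //= j; rewrite (path_sortedE lex_le_trans) => ->.
  rewrite andbT; apply/allP => y; rewrite mem_cat mem_nseq.
  move=> /orP[/andP[_ /eqP->]|/ht /vlt/lex_ltW //]; exact: lexx.
- by rewrite flatten_cat ft.
Qed.

(** In a nondecreasing sequence, the copies of the least word come first. *)
Lemma sorted_split_min v vs s :
  (forall x, x \in vs -> lex_lt v x) ->
  seq_over [set` v :: vs] s -> sorted lex_le s ->
  exists j t, [/\ s = nseq j v ++ t, seq_over [set` vs] t & sorted lex_le t].
Proof.
move=> vlt; elim: s => [|x s IH]; first by exists 0, [::].
move=> /seq_over_cons[/= xv hs] pxs.
have [->|xnv] := eqVneq x v.
  have [j [t [-> ht st]]] := IH hs (path_sorted pxs).
  by exists j.+1, t.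
exists 0, (x :: s); split=> //.
have xvs : x \in vs by move: xv; rewrite inE (negPf xnv).
move: (pxs); rewrite (path_sortedE lex_le_trans) => /andP[/allP xs _].
apply/seq_over_cons; split=> // y ys; have := hs y ys.
rewrite /= inE => /predU1P[yv|//].
have := lex_lt_le_trans (vlt x xvs) (xs y ys).
by rewrite yv lex_lt_irr.
Qed.

(** Cutting off the copies of the least word [v] leaves two products of
    eliminated words, which by [exhausts_star] are products over [(Y \ {v}) v^*];
    the unambiguity of the step at [v] equates both the numbers of copies and the
    remaining products. *)
Lemma exhausts_factor_uniq n Y vs s t :
  code Y -> sorted lex_lt vs -> exhausts n Y vs ->
  seq_over [set` vs] s -> sorted lex_le s ->
  seq_over [set` vs] t -> sorted lex_le t ->
  flatten s = flatten t -> s = t.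
Proof.
elim: vs Y s t => [|v vs IH] Y s t cY.
  case: s => [|x s] _ _; last by move=> h; have := h x (mem_head _ _).
  by case: t => [|x t] // _ _ h; have := h x (mem_head _ _).
move=> /lex_lt_sorted_cons[svs vlt] [Yv ex].
move=> hs ss; have [i [s' [-> {}hs {}ss]]] := sorted_split_min vlt hs ss.
move=> ht st; have [j [t' [-> {}ht {}st]]] := sorted_split_min vlt ht st.
have [s1 hs1 fs1] := exhausts_star ex hs.
have [t1 ht1 ft1] := exhausts_star ex ht.
rewrite !flatten_cat -fs1 -ft1 => /(lazard_step_uniq cY Yv hs1 ht1)[-> st1].
congr (_ ++ _); apply: (IH _ _ _ (code_lazard_step cY Yv) svs ex) => //.
by rewrite -fs1 -ft1 st1.
Qed.

End Increasing.

(** * The eliminated words are the Nyldon words *)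

Section Nyldon.
Context {d : Order.disp_t} {A : orderType d}.
Implicit Types (w : seq A) (s t vs : seq (seq A)).

Lemma nyldon_gt0 w : nyldon w -> 0 < size w.
Proof. by move=> /nyldonP[->|[/ltnW]]. Qed.

Lemma mem_flatten_size (T : eqType) (m : seq T) (s : seq (seq T)) :
  m \in s -> size (flatten s) <= size m -> flatten s = m.
Proof.
elim: s => //= x s IH; rewrite inE size_cat => /predU1P[<-|ms] le.
  move: le; rewrite -[X in _ <= X]addn0 leq_add2l leqn0 => /nilP->.
  by rewrite cats0.
have e := IH ms (leq_trans (leq_addl _ _) le).
by move: le; rewrite e -[X in _ <= X]add0n leq_add2r leqn0 => /nilP->.
Qed.

Lemma flatten_letters w : flatten [seq [:: a] | a <- w] = w.
Proof. by elim: w => //= a w ->. Qed.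

(** Existence of the nondecreasing factorization puts the Nyldon words in [vs],
    uniqueness makes the members of [vs] Nyldon. *)
Lemma exhausts_nyldon n vs w :
  sorted lex_lt vs -> (forall v, v \in vs -> 0 < size v) ->
  exhausts n [set v : seq A | size v = 1] vs ->
  size w <= n -> w \in vs <-> nyldon w.
Proof.
move=> svs vs0 ex; move: {2}(size w) (leqnn (size w)) => k.
elim: k w => [|k IH] w wk wn.
  split=> [/vs0|/nyldon_gt0]; first by rewrite ltnNge wk.
  by rewrite ltnNge wk.
have IHw m : size m < size w -> m \in vs <-> nyldon m.
  move=> mw; apply: IH; last exact: ltnW (leq_trans mw wn).
  by rewrite -ltnS (leq_trans mw).
split=> [wvs|nw].
  apply/nyldonP; have := vs0 w wvs; rewrite leq_eqVlt => /predU1P[->|w1].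
    by left.
  right; split=> // -[s [ws sn sw ss]].
  have e : s = [:: w].
    apply: (exhausts_factor_uniq (@code_letters A) svs ex _ ss) => //.
    - by move=> m ms; apply/(IHw _ (sw m ms)); exact: sn.
    - exact/seq_over_cons.
    - by rewrite /= cats0.
  by have := sw w; rewrite e mem_head ltnn => /(_ isT).
have [||t [ht st ft]] := exhausts_factor (s := [seq [:: a] | a <- w]) svs ex.
- by move=> y /mapP[a _ ->].
- by rewrite flatten_letters.
rewrite flatten_letters in ft.
(* A factor at least as long as the product is the product. *)
have [/hasP[m mt wm]|/hasPn short] := boolP (has (fun m => size w <= size m) t).
  by rewrite -ft (mem_flatten_size mt) ?ft //; exact: ht.
have {}short m : m \in t -> size m < size w by move=> /short; rewrite -ltnNge.
move/nyldonP: nw => [w1|[_ []]]; last first.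
  by exists t; split=> // m mt; apply/IHw; [exact: short|exact: ht].
(* A single letter has no shorter factor, as members of vs are nonempty. *)
case: t ht short ft {st} => [|m t] ht short ft; first by rewrite -ft in w1.
have := vs0 m (ht m (mem_head _ _)).
by have := short m (mem_head _ _); rewrite w1 ltnS leqn0 => /eqP->.
Qed.

End Nyldon.

Section Words.
Context {A : finType}.

Fixpoint words (n : nat) : seq (seq A) :=
  if n is n'.+1 then [::] :: [seq a :: w | a <- enum A, w <- words n']
  else [:: [::]].

Lemma mem_words n (w : seq A) : (w \in words n) = (size w <= n).
Proof.
elim: n w => [|n IH] [|a w] //=; rewrite inE /= ltnS -IH.
apply/allpairsP/idP => [[[b v] [_ /= vn [_ ->]]]//|wn].
by exists (a, w); rewrite mem_enum.
Qed.

End Words.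

Lemma nyldon_exhausts (d : Order.disp_t) (A : finOrderType d) (n : nat)
    (us : seq (seq A)) :
  @nyldon d A `&` words_upto n = [set` us] -> sorted lex_lt us ->
  exhausts n [set w : seq A | size w = 1] us.
Proof.
move=> husn sus.
pose ws : seq (seq A) := sort lex_le (undup [seq w <- words n | w != [::]]).
have mws (w : seq A) : (w \in ws) = (size w <= n) && (w != [::]).
  by rewrite /ws mem_sort mem_undup mem_filter mem_words andbC.
have sws : sorted (@lex_lt d A) ws.
  exact: etrans (@sort_lt_sorted _ (seqlexi A) _) (undup_uniq _).
have [x y|y y1 yn|vs sub ex] :=
  exhausts_exists (n := n) (Y := [set w : seq A | size w = 1]) sws.
- rewrite !mws => /andP[_]; case: x => // a x _.
  by case: y => // b y _ ->.
- by rewrite mws yn; case: y y1 {yn}.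
have svs : sorted lex_lt vs := subseq_sorted lex_lt_trans sub sws.
have vsn v : v \in vs -> (size v <= n) && (v != [::]).
  by move=> /(mem_subseq sub); rewrite mws.
suff -> : us = vs by [].
apply: (irr_sorted_eq lex_lt_trans lex_lt_irr sus svs) => w.
have iff := @exhausts_nyldon d A n vs w svs _ ex.
have usE : w \in us <-> nyldon w /\ size w <= n.
  by have -> : (w \in us : Prop) = (@nyldon d A `&` words_upto n) w by rewrite husn.
have {}iff : size w <= n -> w \in vs <-> nyldon w.
  by apply: iff => v /vsn/andP[_]; case: v.
apply/idP/idP => [/usE[nw wn]|wvs]; first exact/iff.
by have /andP[wn _] := vsn w wvs; apply/usE; split=> //; exact/iff.
Qed.

Theorem theorem56 (d : Order.disp_t) (A : finOrderType d) (hA : 1 < #|A|) :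
  right_lazard (@nyldon d A) (@lex_gt d A).
Proof.
split=> [w /nyldon_gt0|| n us _ us0 husn sus]; first by case: w.
  split=> [u _|u v w _ _ _ uv vw|u v _ _ /eqP uv].
  - by rewrite /lex_gt lex_lt_irr.
  - exact: lex_lt_trans vw uv.
  - by apply/orP; rewrite orbC; exact: lt_total.
have ex := nyldon_exhausts husn sus.
split=> [i ius|].
  by rewrite lazard_setE ?(ltnW ius) //; exact: exhausts_nth ex ius.
case/lastP: us us0 husn sus ex => // us u _ husn _ ex.
have un : size u <= n.
  suff [] : (@nyldon d A `&` words_upto n) u by [].
  by rewrite husn /= mem_rcons mem_head.
have Yu := exhausts_nth (i := size us) ex; move: Yu.
rewrite size_rcons last_rcons lazard_setE ?size_rcons //=.
rewrite nth_rcons ltnn eqxx -cats1 take_size_cat // => /(_ (ltnSn _)) Yu.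
apply/seteqP; split=> [z [Yz zn]|_ ->] //=.
(* Otherwise z itself, the case j = 0, would survive the last elimination. *)
apply: contrapT => zu; have := @exhausts_foldl _ _ _ _ ex z.
rewrite foldl_rcons ltnNge zn => h; suff: false by []; apply: h.
by apply/lazard_stepP; exists z, 0; rewrite /= cats0.
Qed.
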